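(* For every positive integer $t$, the problem $\mathrm{BDIS}_t$ (Online $t$-Bounded Degree Independent Set with Predictions) is exactly as hard as $\mathrm{ASG}_t$ ($(1,t)$-Asymmetric String Guessing with Unknown History and Predictions) with respect to the canonical pair of error measures $(\mu_0,\mu_1)$. That is: for all $\alpha,\beta,\gamma$, if there is an $(\alpha,\beta,\gamma)$-competitive Pareto-optimal algorithm for one of the two problems with respect to $(\mu_0,\mu_1)$, then there is an $(\alpha,\beta,\gamma)$-competitive algorithm for the other problem with respect to $(\mu_0,\mu_1)$.
   Context: Online problems with binary predictions: an instance is a triple $I=(x,\hat x,r)$, where $r=(r_1,\dots,r_n)$ is a sequence of requests and $x,\hat x\in\{0,1\}^n$. Requests are revealed one at a time; together with $r_i$ a deterministic online algorithm receives the prediction $\hat x_i$ and must irrevocably output a bit $y_i\in\{0,1\}$ before $r_{i+1}$ is revealed. The (unrevealed) string $x$ encodes an optimal solution ($x_i$ is the optimal output on $r_i$). For a maximization problem, $\mathrm{Alg}(I)$ and $\mathrm{Opt}(I)$ denote the profit of the algorithm and of an optimal solution; for a minimization problem they denote costs. Canonical error measures: $\mu_0(I)=\sum_{i=1}^n x_i(1-\hat x_i)$ and $\mu_1(I)=\sum_{i=1}^n(1-x_i)\hat x_i$. For $\alpha,\beta,\gamma\ge 0$, an algorithm for a maximization problem is $(\alpha,\beta,\gamma)$-competitive w.r.t. $(\mu_0,\mu_1)$ if there is a constant $b\in\mathbb R$ with $\mathrm{Opt}(I)\le\alpha\,\mathrm{Alg}(I)+\beta\mu_0(I)+\gamma\mu_1(I)+b$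 for all instances $I$; for a minimization problem the requirement is $\mathrm{Alg}(I)\le\alpha\,\mathrm{Opt}(I)+\beta\mu_0(I)+\gamma\mu_1(I)+b$ for all $I$. An $(\alpha,\beta,\gamma)$-competitive algorithm is Pareto-optimal if for no $\varepsilon>0$ there exists an $(\alpha-\varepsilon,\beta,\gamma)$-, an $(\alpha,\beta-\varepsilon,\gamma)$- or an $(\alpha,\beta,\gamma-\varepsilon)$-competitive algorithm for the same problem. Problem $Q$ is as hard as $P$ (w.r.t. given error measures) if for all $\alpha,\beta,\gamma$ the existence of an $(\alpha,\beta,\gamma)$-competitive Pareto-optimal algorithm for $Q$ implies the existence of an $(\alpha,\beta,\gamma)$-competitive algorithm for $P$; ''exactly as hard as'' means each is as hard as the other. $\mathrm{ASG}_t$: request $r_i$ is a prompt to guess the bit $x_i$ (given prediction $\hat x_i$); the algorithm outputs a guess $y_i$; after all guesses $x$ is revealed. The cost is $\sum_{i=1}^n\big(y_i+t\,x_i(1-y_i)\big)$, to be minimized; $\mathrm{Opt}(I)=\sum_i x_i$. $\mathrm{BDIS}_t$: vertex-arrival problem: request $r_i$ contains a new vertex $v_i$ of the input graph $G$ together with all edges of $G$ between $v_i$ and $v_1,\dots,v_{i-1}$; every input graph has maximum degree at most $t$. Output $y_i=0$ means $v_i$ is added to the algorithm's independent set; $\{v_i: x_i=0\}$ is a maximum independent set of $G$. The profit is $\sum_i(1-y_i)$ if the accepted vertices form an independent set and $-\infty$ otherwise; to be maximized. *)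

(* Defs.v *)
From mathcomp Require Import all_boot all_order all_algebra finmap.
From mathcomp Require Import reals constructive_ereal.

Set Implicit Arguments.
Unset Strict Implicit.
Unset Printing Implicit Defensive.

Import Order.TTheory GRing.Theory Num.Theory.

Local Open Scope ring_scope.

Record instance (Req : Type) := Instance {
  ilen : nat;
  isol : ilen.-tuple bool;
  ipred : ilen.-tuple bool;
  ireq : ilen.-tuple Req }.

(* A deterministic online algorithm maps everything revealed so far, i.e. the
   pairs (r_1, xhat_1), ..., (r_i, xhat_i) in this order, to the bit y_i.  Its
   own earlier outputs are functions of this history. *)
Definition online_algorithm (Req : Type) := seq (Req * bool) -> bool.

Definition output (Req : Type) (A : online_algorithm Req) (I : instance Req) :
    (ilen I).-tuple bool :=
  [tuple A (take i.+1 (zip (ireq I) (ipred I))) | i < ilen I].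

Inductive objective := Minimize | Maximize.

(* [value I y] is the cost or profit of the output y on I; it lives in \bar R
   so that infeasible outputs can be given an infinite value. The convention
   0 * -oo = 0 of \bar R only matters for triples with alpha = 0, which no
   algorithm attains for BDIS below (take edgeless graphs and xhat = x). *)
Record online_problem (R : realType) := OnlineProblem {
  request : Type;
  goal : objective;
  is_instance : instance request -> Prop;
  value : forall I : instance request, (ilen I).-tuple bool -> \bar R;
  opt : instance request -> R }.

Section Competitiveness.
Variable R : realType.

Definition mu0 (Req : Type) (I : instance Req) : R :=
  \sum_(i < ilen I) (tnth (isol I) i)%:R * (1 - (tnth (ipred I) i)%:R).

Definition mu1 (Req : Type) (I : instance Req) : R :=
  \sum_(i < ilen I) (1 - (tnth (isol I) i)%:R) * (tnth (ipred I) i)%:R.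

Definition alg_value (P : online_problem R) (A : online_algorithm (request P))
    (I : instance (request P)) : \bar R :=
  value (output A I).

(* The sign conditions are part of the notion: a triple with a negative entry
   is never attained, which matters for the triples in [pareto_optimal]. *)
Definition competitive (P : online_problem R) (alpha beta gamma : R)
    (A : online_algorithm (request P)) : Prop :=
  [/\ 0 <= alpha, 0 <= beta, 0 <= gamma
    & exists b : R, forall I : instance (request P), is_instance I ->
        match goal P with
        | Minimize =>
            (alg_value A I <= (alpha * opt I + beta * mu0 I
                               + gamma * mu1 I + b)%:E)%E
        | Maximize =>
            ((opt I)%:E <= alpha%:E * alg_value A I
                           + (beta * mu0 I + gamma * mu1 I + b)%:E)%E
        end].

Definition pareto_optimal (P : online_problem R) (alpha beta gamma : R)
    (A : online_algorithm (request P)) : Prop :=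
  competitive alpha beta gamma A /\
  forall eps : R, 0 < eps ->
    [/\ ~ (exists B : online_algorithm (request P),
             competitive (alpha - eps) beta gamma B),
        ~ (exists B : online_algorithm (request P),
             competitive alpha (beta - eps) gamma B)
      & ~ (exists B : online_algorithm (request P),
             competitive alpha beta (gamma - eps) B)].

Definition as_hard_as (Q P : online_problem R) : Prop :=
  forall alpha beta gamma : R,
    (exists A : online_algorithm (request Q),
       pareto_optimal alpha beta gamma A) ->
    exists B : online_algorithm (request P), competitive alpha beta gamma B.

Definition exactly_as_hard_as (Q P : online_problem R) : Prop :=
  as_hard_as Q P /\ as_hard_as P Q.

End Competitiveness.

Section AsymmetricStringGuessing.
Variables (R : realType) (t : nat).

(* A request is a mere prompt, so it carries no information. *)
Definition ASG_cost (I : instance unit) (y : (ilen I).-tuple bool) : \bar R :=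
  (\sum_(i < ilen I) ((tnth y i)%:R
     + t%:R * (tnth (isol I) i)%:R * (1 - (tnth y i)%:R)))%:E.

Definition ASG_opt (I : instance unit) : R :=
  \sum_(i < ilen I) (tnth (isol I) i)%:R.

Definition ASG : online_problem R :=
  @OnlineProblem R unit Minimize (fun=> True) ASG_cost ASG_opt.

End AsymmetricStringGuessing.

(* Vertices are named 0, 1, ... in order of arrival; the request for vertex i
   is the set of its neighbours among the vertices j < i. *)
Section VertexArrivalGraph.
Variables (n : nat) (r : n.-tuple {fset nat}).

Definition vertex_arrival : Prop :=
  forall (i : 'I_n) (j : nat), j \in tnth r i -> (j < i)%N.

Definition edge : rel 'I_n :=
  fun i j => (val j \in tnth r i) || (val i \in tnth r j).

Definition max_degree_le (t : nat) : Prop :=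
  forall i : 'I_n, (#|[set j | edge i j]| <= t)%N.

Definition independent (S : {set 'I_n}) : bool :=
  [forall i in S, forall j in S, ~~ edge i j].

Definition independence_number : nat :=
  (\max_(S : {set 'I_n} | independent S) #|S|)%N.

Definition maximum_independent (S : {set 'I_n}) : Prop :=
  independent S /\ #|S| = independence_number.

End VertexArrivalGraph.

(* The bit 0 means that the vertex is taken. *)
Definition accepted (n : nat) (y : n.-tuple bool) : {set 'I_n} :=
  [set i | ~~ tnth y i].

Section BoundedDegreeIndependentSet.
Variables (R : realType) (t : nat).

Definition BDIS_instance (I : instance {fset nat}) : Prop :=
  [/\ vertex_arrival (ireq I), max_degree_le (ireq I) t
    & maximum_independent (ireq I) (accepted (isol I))].

Definition BDIS_profit (I : instance {fset nat}) (y : (ilen I).-tuple bool) :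
    \bar R :=
  if independent (ireq I) (accepted y)
  then (\sum_(i < ilen I) (1 - (tnth y i)%:R))%:E else -oo%E.

Definition BDIS_opt (I : instance {fset nat}) : R :=
  (independence_number (ireq I))%:R.

Definition BDIS : online_problem R :=
  @OnlineProblem R {fset nat} Maximize BDIS_instance BDIS_profit BDIS_opt.

End BoundedDegreeIndependentSet.

(* Main.v *)
(** The two problems have literally the same attainable triples: [alpha >= 1],
    [alpha + beta >= t], and [alpha >= t] or [gamma >= 1].

    Lower bounds: edgeless graphs and the string [1 ... 1], correctly predicted,
    give [alpha >= 1].  For the rest, the adversary fixes a constant prediction
    [q] and makes every answer of the algorithm wrong.  For ASG it sets
    [x_i = 1 - y_i].  For BDIS it offers an isolated vertex; a rejected one has
    [x_i = 0], an accepted one becomes the centre of a star with [t] correctly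
    predicted leaves, all of which the algorithm has to reject.  Either way a
    mistake costs [t] against [alpha + beta (1 - q)] or [1] against [gamma q].

    Upper bounds: if [alpha >= t] ignore the predictions, otherwise follow them.
    For BDIS this means taking greedily the vertices that are not predicted to
    be rejected.  An accepted vertex outside the optimal solution blocks at most
    [t] vertices of that solution. *)
Require Import Defs.
From mathcomp Require Import all_boot all_order all_algebra finmap.
From mathcomp Require Import reals constructive_ereal.
From mathcomp Require Import lra zify.

Set Implicit Arguments.
Unset Strict Implicit.
Unset Printing Implicit Defensive.

Import Order.TTheory GRing.Theory Num.Theory.

Local Open Scope ring_scope.

(* At [q = false] the disjunction reads [t <= alpha + beta], as [1 <= 0] fails;
   at [q = true] it reads [t <= alpha \/ 1 <= gamma]. *)
Definition attainable (R : realType) (t : nat) (alpha beta gamma : R) : Prop :=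
  1 <= alpha /\
  forall q : bool, t%:R <= alpha + beta * (1 - q%:R) \/ 1 <= gamma * q%:R.

(** Repeating a round [n] times makes the additive constant [b] of competitiveness negligible, which
    leaves an inequality per round. *)
Lemma linear_bounded_le0 (R : realType) (c b : R) :
  (forall n : nat, c * n%:R <= b) -> c <= 0.
Proof.
move=> H; rewrite leNgt; apply/negP => c_gt0.
have b_ge0 : 0 <= b by have := H 0%N; rewrite mulr0.
have := archi_boundP (divr_ge0 b_ge0 (ltW c_gt0)).
by rewrite ltr_pdivrMr // mulrC ltNge H.
Qed.

(** Every adversarial round gains at least the smaller of the gains [x - u] and [y - v] of the two
    kinds of mistakes; bounding that minimum yields the disjunction in [attainable]. *)
Lemma min_le0_or (R : realType) (x y u v : R) :
  Num.min (x - u) (y - v) <= 0 -> x <= u \/ y <= v.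
Proof. by rewrite ge_min !subr_le0 => /orP. Qed.

Section Instances.
Variables (R : realType) (Req : Type).
Implicit Types T : seq (Req * bool * bool).

(* Triples are (request, prediction, solution bit). *)
Definition instance_of T : instance Req :=
  @Instance Req (size T) (map_tuple snd (in_tuple T))
    (map_tuple (fun z => z.1.2) (in_tuple T))
    (map_tuple (fun z => z.1.1) (in_tuple T)).

Lemma zip_history T :
  zip (ireq (instance_of T)) (ipred (instance_of T)) = unzip1 T.
Proof. by rewrite /= zip_map; apply: eq_map => -[[]]. Qed.

Lemma mu0_instance_of T :
  mu0 R (instance_of T) = \sum_(z <- T) z.2%:R * (1 - z.1.2%:R).
Proof. by rewrite big_tnth; apply: eq_bigr => i _; rewrite !tnth_map. Qed.

Lemma mu1_instance_of T :
  mu1 R (instance_of T) = \sum_(z <- T) (1 - z.2%:R) * z.1.2%:R.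
Proof. by rewrite big_tnth; apply: eq_bigr => i _; rewrite !tnth_map. Qed.

Lemma tnth_ireq_instance_of T (d : Req * bool * bool)
    (i : 'I_(ilen (instance_of T))) :
  tnth (ireq (instance_of T)) i = (nth d T i).1.1.
Proof. by rewrite tnth_map (tnth_nth d). Qed.

Lemma tnth_isol_instance_of T (d : Req * bool * bool)
    (i : 'I_(ilen (instance_of T))) :
  tnth (isol (instance_of T)) i = (nth d T i).2.
Proof. by rewrite tnth_map (tnth_nth d). Qed.

End Instances.

Lemma edge_sym n (r : n.-tuple {fset nat}) : symmetric (edge r).
Proof. by move=> i j; rewrite /edge orbC. Qed.

Lemma independentP n (r : n.-tuple {fset nat}) (S : {set 'I_n}) :
  reflect {in S &, forall i j, ~~ edge r i j} (independent r S).
Proof.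
apply: (iffP 'forall_in_'forall_in_idP) => H i j.
  by move=> iS jS; apply: H.
by move=> iS; apply: H.
Qed.

Lemma sum_bool_card (R : realType) n (b : pred 'I_n) :
  \sum_(i < n) (b i)%:R = #|[set i | b i]|%:R :> R.
Proof.
rewrite -sum1dep_card natr_sum [RHS]big_mkcond.
by apply: eq_bigr => i _; case: (b i).
Qed.

Lemma card_bigcup_bounded (T U : finType) (A : {set T}) (F : T -> {set U}) k :
  (forall i, (#|F i| <= k)%N) -> (#|\bigcup_(i in A) F i| <= k * #|A|)%N.
Proof.
move=> Fk; rewrite mulnC -sum_nat_const.
elim/big_rec2: _ => [|i m S _ IH]; first by rewrite cards0.
by rewrite cardsU (leq_trans (leq_subr _ _)) // leq_add.
Qed.

(** * String guessing: attainable triples *)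

Section ASG.
Variables (R : realType) (t : nat).
Hypothesis t_gt0 : (0 < t)%N.
Implicit Types alpha beta gamma : R.

Lemma ASG_attainable alpha beta gamma (A : online_algorithm unit) :
  competitive (P := ASG R t) alpha beta gamma A ->
  attainable t alpha beta gamma.
Proof.
have t_ge1 : 1 <= t%:R :> R by rewrite ler1n.
move=> [a0 b0 g0 [b H]]; rewrite /= in H.
(* Under constant predictions the history does not depend on the solution, so [x] may be chosen
   after all answers are known. *)
pose y q i := A (nseq i.+1 (tt, q)).
have bound (x : nat -> bool) q c :
    (forall i, c <= (y q i)%:R + t%:R * (x i)%:R * (1 - (y q i)%:R)
       - (alpha * (x i)%:R + beta * ((x i)%:R * (1 - q%:R))
          + gamma * ((1 - (x i)%:R) * q%:R))) -> c <= 0.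
  move=> cP; apply: (@linear_bounded_le0 _ _ b) => n.
  pose J := @Instance unit n [tuple x i | i < n] (nseq_tuple n q)
              (nseq_tuple n tt).
  have yE i : tnth (output A J) i = y q i.
    rewrite tnth_mktuple /=; congr A.
    have -> : zip (nseq n tt) (nseq n q) = nseq n (tt, q).
      by elim: (n) => //= k ->.
    by rewrite take_nseq.
  have := H J I; rewrite /alg_value /= /ASG_cost lee_fin /ASG_opt /mu0 /mu1.
  rewrite !mulr_sumr -!big_split /= -lerBlDl -sumrB; apply: le_trans.
  rewrite mulr_natr -[leLHS]/(c *+ n) -[n in c *+ n]card_ord -sumr_const.
  by apply: ler_sum => i _; rewrite yE !tnth_mktuple
    (tnth_nth q) nth_nseq ltn_ord.
split=> [|q].
  rewrite -subr_le0; apply: (bound (fun=> true) true) => i.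
  by case: (y _ _) => /=; lra.
apply: min_le0_or; apply: (bound (fun i => ~~ y q i) q) => i.
rewrite ge_min; case: (y _ _) => /=; apply/orP; [right|left]; lra.
Qed.

Lemma ASG_competitive alpha beta gamma :
  0 <= beta -> 0 <= gamma -> attainable t alpha beta gamma ->
  exists A : online_algorithm unit,
    competitive (P := ASG R t) alpha beta gamma A.
Proof.
have t_ge1 : 1 <= t%:R :> R by rewrite ler1n.
move=> b0 g0 [a1 aP].
(* If [t <= alpha], always guessing 0 is paid for by [alpha]. Otherwise [aP true] gives
   [1 <= gamma], which pays for false predictions of 1, and [aP false] gives [t <= alpha + beta],
   which pays for missed ones. *)
pose trust := alpha < t%:R.
exists (fun h => trust && last false (unzip2 h)); split=> //; first lra.
exists 0 => J _ /=; rewrite /alg_value /= /ASG_cost lee_fin /ASG_opt /mu0 /mu1.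
rewrite addr0 !mulr_sumr -!big_split; apply: ler_sum => i _ /=.
have -> : tnth (output (fun h => trust && last false (unzip2 h)) J) i
          = trust && tnth (ipred J) i.
  rewrite tnth_mktuple; congr (_ && _).
  rewrite /unzip2 map_take -/unzip2 unzip2_zip ?size_tuple //.
  by rewrite (take_nth false) ?size_tuple // last_rcons (tnth_nth false).
rewrite /trust; have := aP true; have := aP false; rewrite /=.
by case: ltP; case: (tnth (ipred J) i); case: (tnth (isol J) i) => /=; lra.
Qed.

End ASG.

(** * The greedy independent set algorithm *)

Section Greedy.
(* Whether vertices predicted to be rejected are withheld from the greedy
   choice. *)
Variable trust : bool.

(** The state [s] lists the answers so far; by the default [true], a vertex that has not arrived
    counts as rejected. *)
Definition greedy_step (s : seq bool) (z : {fset nat} * bool) : seq bool :=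
  rcons s ((trust && z.2) || has (fun j => ~~ nth true s j) z.1).

Definition greedy : online_algorithm {fset nat} :=
  fun h => last true (foldl greedy_step [::] h).

Lemma foldl_greedy_step (h : seq ({fset nat} * bool)) :
  foldl greedy_step [::] h = mkseq (fun i => greedy (take i.+1 h)) (size h).
Proof.
elim/last_ind: h => [//|h z IH].
rewrite size_rcons mkseqS take_oversize ?size_rcons //.
rewrite /greedy !foldl_rcons last_rcons {1}/greedy_step; congr rcons.
rewrite IH; apply/eq_in_map => i; rewrite mem_iota add0n /= => lt_i_h.
by rewrite -[rcons h z]cats1 takel_cat.
Qed.

Lemma greedyE (I : instance {fset nat}) (i : 'I_(ilen I)) :
  vertex_arrival (ireq I) ->
  tnth (output greedy I) i =
    (trust && tnth (ipred I) i)
    || [exists j : 'I_(ilen I),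
          (val j \in tnth (ireq I) i) && ~~ tnth (output greedy I) j].
Proof.
move=> arr; rewrite tnth_mktuple.
set h := zip _ _; have sz_h : size h = ilen I.
  by rewrite size1_zip !size_tuple.
pose d : {fset nat} * bool := (fset0, false).
have outE (j : 'I_(ilen I)) : tnth (output greedy I) j = greedy (take j.+1 h).
  by rewrite tnth_mktuple.
rewrite (take_nth d) ?sz_h // {1}/greedy foldl_rcons last_rcons.
rewrite foldl_greedy_step.
rewrite nth_zip ?size_tuple //= -!tnth_nth; congr (_ || _).
apply/hasP/existsP => [[j j_r]|[j /andP[j_r yj]]].
  have lt_ji := arr _ _ j_r.
  have lt_j : (j < ilen I)%N by apply: ltn_trans lt_ji _.
  rewrite (minn_idPl (ltnW (ltn_ord i))) nth_mkseq // take_takel // => yj.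
  by exists (Ordinal lt_j); rewrite /= j_r outE.
exists (val j) => //; have lt_ji := arr _ _ j_r.
by rewrite (minn_idPl (ltnW (ltn_ord i))) nth_mkseq // take_takel //= -outE.
Qed.

End Greedy.

(** * The adaptive star forest for independent set *)

Section Adversary.
Variables (R : realType) (t : nat).
Variables (A : online_algorithm {fset nat}) (q : bool).
Implicit Types T : seq ({fset nat} * bool * bool).

(** The answer [y] is determined by the history before the solution bit is set against it; [size T]
    is the index of the new vertex, hence the centre of its leaves. *)
Definition round T : seq ({fset nat} * bool * bool) :=
  let y := A (rcons (unzip1 T) (fset0, q)) in
  (fset0, q, ~~ y) ::
    if y then [::] else nseq t ([fset size T]%fset, false, false).

Definition adversary n := iter n (fun T => T ++ round T) [::].

(** Past the end there are no neighbours and no roots, so the first two clauses of [star_forest] can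
    range over all indices. *)
Let d : {fset nat} * bool * bool := (fset0, false, false).

Definition reqs T i := (nth d T i).1.1.
Definition sol T i := (nth d T i).2.
Definition answer T i := A (take i.+1 (unzip1 T)).

(* The last clause is what confines the vertices accepted by a feasible output
   to the roots with solution bit 1. *)
Definition star_forest T : Prop :=
  [/\ forall i j, j \in reqs T i ->
        [/\ (j < i <= j + t)%N, sol T j, ~~ sol T i & reqs T i = [fset j]%fset],
      forall i, sol T i ->
        [/\ (i.+1 < size T)%N, i \in reqs T i.+1 & ~~ answer T i]
    & forall i, (i < size T)%N -> ~~ sol T i ->
        answer T i \/ exists j, j \in reqs T i].

(** Old indices keep their triples and answers, so only the new vertex and its leaves need checking;
    [0 < t] supplies the leaf at [i.+1] demanded of a root. *)
Lemma star_forest_round T :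
  (0 < t)%N -> star_forest T -> star_forest (T ++ round T).
Proof.
move=> t_gt0 [edgeP rootP leafP].
set n := size T; set y := A (rcons (unzip1 T) (fset0, q)).
have lt_nth i : (i < n)%N -> nth d (T ++ round T) i = nth d T i.
  by move=> lt_in; rewrite nth_cat lt_in.
have ge_nth k : nth d (T ++ round T) (n + k) = nth d (round T) k.
  by rewrite nth_cat ltnNge leq_addr /= addKn.
have lt_ans i : (i < n)%N -> answer (T ++ round T) i = answer T i.
  by move=> lt_in; rewrite /answer /unzip1 map_cat takel_cat // size_map.
have n_ans : answer (T ++ round T) n = y.
  rewrite /answer /unzip1 map_cat take_cat size_map ltnNge leqnSn /=.
  by rewrite (_ : n.+1 - size T = 1)%N ?subSnn // take_cons take0 cats1.
have lt_of i : (n <= i)%N -> i = (n + (i - n))%N by move/subnKC.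
have nthE k : nth d (round T) k.+1 =
    if ~~ y && (k < t)%N then ([fset n]%fset, false, false) else d.
  rewrite /round -/y -/n /=; case: (y) => /=; first by rewrite nth_nil.
  by rewrite nth_nseq.
have nth0E : nth d (round T) 0 = (fset0, q, ~~ y) by [].
have sz : size (T ++ round T) = (n + (if y then 1 else t.+1))%N.
  by rewrite size_cat /round -/y /=; case: (y); rewrite //= size_nseq.
have sol_n : sol (T ++ round T) n = ~~ y by rewrite /sol -[n]addn0 ge_nth.
split=> [i j|i|i].
- rewrite /reqs /sol; case: (ltnP i n) => [lt_in|/lt_of ->].
    rewrite lt_nth // => jr; have [lt_ji sj si re] := edgeP _ _ jr.
    by rewrite lt_nth //; lia.
  rewrite ge_nth; case: (i - n)%N => [|k]; first by rewrite nth0E inE.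
  rewrite nthE; case: ifP => [/andP[ny lt_kt]|_]; rewrite ?inE //=.
  move=> /eqP ->; split=> //; first lia.
  by have := sol_n; rewrite /sol => ->.
- case: (ltnP i n) => [lt_in|/lt_of ->].
    rewrite /sol lt_nth // => /rootP[lt_i ir ya].
    by rewrite lt_ans // /reqs lt_nth // sz; split=> //; lia.
  rewrite /sol ge_nth; case: (i - n)%N => [|k]; last by rewrite nthE; case: ifP.
  rewrite nth0E addn0 /= => ny; rewrite n_ans ny sz (negbTE ny).
  split=> //; first lia.
  by rewrite /reqs -addn1 ge_nth nthE ny t_gt0 inE.
- rewrite sz; case: (ltnP i n) => [lt_in _|/lt_of ->].
    by rewrite lt_ans // /sol /reqs lt_nth //; apply: leafP.
  rewrite ltn_add2l /sol /reqs ge_nth; case: (i - n)%N => [_|k].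
    by rewrite nth0E addn0 /= n_ans negbK; left.
  rewrite nthE; case: (y) => //= lt_kt _; right; exists n.
  by rewrite -ltnS lt_kt inE.
Qed.

Lemma star_forest_adversary n : (0 < t)%N -> star_forest (adversary n).
Proof.
move=> t_gt0; elim: n => [|n IH]; last exact: star_forest_round.
by split=> [i j|i|i]; rewrite /reqs /sol ?nth_nil //= inE.
Qed.

Section StarForest.
Variable T : seq ({fset nat} * bool * bool).
Hypothesis forest : star_forest T.
Local Notation J := (instance_of T).

Lemma reqsE (i : 'I_(ilen J)) : tnth (ireq J) i = reqs T i.
Proof. exact: tnth_ireq_instance_of. Qed.

Lemma solE (i : 'I_(ilen J)) : tnth (isol J) i = sol T i.
Proof. exact: tnth_isol_instance_of. Qed.

Lemma answerE (i : 'I_(ilen J)) : tnth (output A J) i = answer T i.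
Proof. by rewrite tnth_mktuple zip_history. Qed.

Lemma star_forest_arrival : vertex_arrival (ireq J).
Proof.
have [edgeP _ _] := forest.
by move=> i j; rewrite reqsE => /edgeP[/andP[]].
Qed.

Lemma star_forest_degree : (0 < t)%N -> max_degree_le (ireq J) t.
Proof.
have [edgeP _ _] := forest; move=> t_gt0 i.
have [x1|x0] := boolP (sol T i).
  (* The leaves of a root lie among the next [t] indices, so the offset [j - i] maps them
     injectively to nonzero values. *)
  pose f (j : 'I_(ilen J)) : 'I_t.+1 := inord (j - i).
  have nbr j : j \in [set j | edge (ireq J) i j] -> (i < j <= i + t)%N.
    by rewrite inE /edge !reqsE => /orP[/edgeP[_ _]|/edgeP[]//]; rewrite x1.
  have f_inj : {in [set j | edge (ireq J) i j] &, injective f}.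
    move=> j k /nbr jP /nbr kP /(congr1 val) /=; rewrite !inordK; try lia.
    by move=> E; apply/val_inj; rewrite /= in jP kP E *; lia.
  have card_t : #|[set~ ord0 : 'I_t.+1]| = t by rewrite cardsC1 card_ord.
  rewrite -(card_in_imset f_inj) -[leqRHS]card_t.
  apply/subset_leq_card/subsetP => _ /imsetP[j /nbr jP ->].
  rewrite !inE -val_eqE /= inordK; lia.
apply: leq_trans t_gt0; apply/card_le1_eqP => j k.
rewrite !inE /edge !reqsE.
case/orP => [jr|/edgeP[_]]; last by rewrite (negbTE x0).
case/orP => [kr|/edgeP[_]]; last by rewrite (negbTE x0).
have [_ _ _ re] := edgeP _ _ jr; move: kr; rewrite re inE => /eqP kj.
exact/val_inj.
Qed.

Lemma star_forest_maximum : maximum_independent (ireq J) (accepted (isol J)).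
Proof.
have [edgeP rootP _] := forest.
have ind : independent (ireq J) (accepted (isol J)).
  apply/independentP => i j; rewrite !inE !solE /edge !reqsE => xi xj.
  by apply/norP; split; apply/negP => /edgeP[_];
    rewrite ?(negbTE xi) ?(negbTE xj).
split=> //; apply/eqP; rewrite eqn_leq; apply/andP; split.
  exact: (@leq_bigmax_cond _ (independent (ireq J)) (fun S => #|S|)).
apply/bigmax_leqP => S /independentP S_ind.
(* An independent set cannot contain both a root and its first leaf, so trading
   every chosen root for that leaf loses no vertex. *)
pose f (i : 'I_(ilen J)) := if tnth (isol J) i then insubd i i.+1 else i.
have fE i : tnth (isol J) i -> f i = i.+1 :> nat /\ edge (ireq J) (f i) i.
  move=> xi; have := xi; rewrite solE => /rootP[lt_i ir _].
  have E : f i = i.+1 :> nat by rewrite /f xi val_insubd lt_i.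
  by split=> //; rewrite /edge !reqsE /= E ir.
have f_inj : {in S &, injective f}.
  move=> i j iS jS; rewrite /f.
  case xi: (tnth _ i); case xj: (tnth _ j) => //.
  - move=> E; have [Ei _] := fE i xi; have [Ej _] := fE j xj.
    by apply: val_inj; apply: succn_inj; rewrite -Ei -Ej /f xi xj E.
  - move=> E; have [_] := fE i xi; rewrite /f xi E.
    by rewrite (negbTE (S_ind _ _ _ _)).
  - move=> E; have [_] := fE j xj; rewrite /f xj -E.
    by rewrite (negbTE (S_ind _ _ _ _)).
rewrite -(card_in_imset f_inj); apply/subset_leq_card/subsetP.
move=> _ /imsetP[i iS ->]; rewrite inE.
have [xi|xi] := boolP (tnth (isol J) i); last by rewrite /f (negbTE xi).
have [Ei _] := fE i xi; move: xi; rewrite !solE Ei => xi.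
by have [_ /edgeP[]] := rootP _ xi.
Qed.

(** An accepted vertex with bit 0 would be a leaf, and its root is accepted too. *)
Lemma star_forest_answer (i : 'I_(ilen J)) :
  independent (ireq J) (accepted (output A J)) ->
  ~~ tnth (output A J) i -> tnth (isol J) i.
Proof.
have [edgeP rootP leafP] := forest.
move=> /independentP ind yi; rewrite solE; apply: contraT => xi.
case: (leafP i (ltn_ord i) xi) => [|[j jr]].
  by rewrite -answerE (negbTE yi).
have [lt_ji xj _ _] := edgeP _ _ jr; have [_ _ yj] := rootP _ xj.
have lt_j : (j < ilen J)%N by have := ltn_ord i; lia.
have := ind i (Ordinal lt_j); rewrite !inE yi answerE yj /edge reqsE jr.
by move/(_ isT isT).
Qed.

End StarForest.

(** The sum is the optimum minus the competitive bound without [b], with the profit replaced by the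
    number of roots. A star adds [t] for its leaves and subtracts [alpha + beta * (1 - q)] for its
    root; a rejected vertex adds [1 - gamma * q]. *)
Lemma adversary_potential (c alpha beta gamma : R) n :
  c <= t%:R - (alpha + beta * (1 - q%:R)) -> c <= 1 - gamma * q%:R ->
  c * n%:R <= \sum_(z <- adversary n) ((1 - z.2%:R)
    - (alpha * z.2%:R + beta * (z.2%:R * (1 - z.1.2%:R))
       + gamma * ((1 - z.2%:R) * z.1.2%:R))).
Proof.
move=> c1 c2; elim: n => [|n IH]; first by rewrite big_nil mulr0.
rewrite /= big_cat -natr1 mulrDr mulr1 lerD // /round big_cons.
case: (A _) => /=; first by rewrite big_nil; lra.
by rewrite big_nseq iter_addr /= -[(1 - _ - _) *+ t]mulr_natr; lra.
Qed.

End Adversary.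

(** * Independent set: attainable triples *)

Section BDIS.
Variables (R : realType) (t : nat).
Implicit Types alpha beta gamma : R.

Lemma BDIS_competitive alpha beta gamma :
  0 <= beta -> 0 <= gamma -> attainable t alpha beta gamma ->
  exists A : online_algorithm {fset nat},
    competitive (P := BDIS R t) alpha beta gamma A.
Proof.
move=> b0 g0 [a1 aP].
pose trust := alpha < t%:R.
exists (greedy trust); split=> //; first lra.
exists 0 => J [arr deg [opt_ind opt_card]].
rewrite /alg_value /= /BDIS_profit /BDIS_opt -opt_card.
set y := output _ J; pose x := isol J; pose p := ipred J.
have yE i : tnth y i = (trust && tnth p i)
    || [exists j : 'I_(ilen J), (val j \in tnth (ireq J) i) && ~~ tnth y j].
  exact: greedyE.
have y_ind : independent (ireq J) (accepted y).
  suff H i j :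
      i \in accepted y -> j \in accepted y -> val j \notin tnth (ireq J) i.
    by apply/independentP => i j iy jy; rewrite negb_or !H.
  rewrite !inE => yi yj; apply/negP => jr; move: yi; rewrite yE.
  by case/norP => _ /existsP[]; exists j; rewrite jr.
rewrite y_ind -EFinM -EFinD lee_fin.
pose A0 := [set i | ~~ tnth y i && ~~ tnth x i].
pose A1 := [set i | ~~ tnth y i && tnth x i].
pose M := [set i | trust && ~~ tnth x i && tnth p i].
(* [M]: optimal vertices withheld because of their prediction; [A0], [A1]:
   accepted vertices inside and outside the optimal solution. *)
have cover : (#|accepted x| <= #|M| + #|A0| + t * #|A1|)%N.
  pose N := \bigcup_(j in A1) [set i | edge (ireq J) j i].
  apply: (@leq_trans #|M :|: A0 :|: N|).
    apply/subset_leq_card/subsetP => i.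
    rewrite !inE => xi; rewrite xi !andbT.
    case yi: (tnth y i) => //=; rewrite ?orbT // orbF.
    (* A rejected optimal vertex is withheld or has an accepted neighbour [j]; independence of the
       optimal solution puts [j] in [A1]. *)
    move: (yE i); rewrite yi => /esym /orP[-> //|/existsP[j /andP[jr yj]]].
    apply/orP; right; apply/bigcupP.
    exists j; last by rewrite inE edge_sym /edge jr.
    rewrite inE yj /=; apply: contraLR (jr) => xj.
    have /independentP/(_ i j) := opt_ind.
    by rewrite !inE => /(_ xi xj); rewrite /edge negb_or => /andP[].
  apply: leq_trans (leq_card_setU _ _) _; rewrite leq_add //.
    exact: leq_card_setU.
  exact: card_bigcup_bounded.
have {}cover : #|accepted x|%:R <= #|M|%:R + #|A0|%:R + t%:R * #|A1|%:R :> R.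
  by rewrite -natrM -!natrD ler_nat.
apply: le_trans cover _; rewrite -!sum_bool_card /mu0 /mu1 addr0 !mulr_sumr.
rewrite -!big_split; apply: ler_sum => i _ /=; rewrite -/p -/x.
(* Under [trust] an accepted vertex is predicted 0, so one outside the optimal solution is paid for
   by [t <= alpha + beta]. *)
have yp : ~~ tnth y i -> ~~ (trust && tnth p i).
  by rewrite yE negb_or => /andP[].
move: yp; rewrite /trust; have := aP true; have := aP false; rewrite /=.
case: ltP; case: (tnth y i); case: (tnth p i); case: (tnth x i) => //= ? ? ? yp;
  by [lra | have := yp isT].
Qed.

Lemma BDIS_opt_accepted (I : instance {fset nat}) :
  BDIS_instance t I ->
  BDIS_opt R I = \sum_(i < ilen I) (1 - (tnth (isol I) i)%:R).
Proof.
move=> [_ _ [_ card_opt]]; rewrite /BDIS_opt -card_opt -sum_bool_card.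
by apply: eq_bigr => i _; case: (tnth _ i); rewrite ?subrr ?subr0.
Qed.

Lemma edgeless_independent (J : instance {fset nat}) (S : {set 'I_(ilen J)}) :
  (forall i, tnth (ireq J) i = fset0) -> independent (ireq J) S.
Proof.
by move=> rE; apply/independentP => i j _ _; rewrite /edge !rE !inE.
Qed.

Lemma edgeless_BDIS_instance (J : instance {fset nat}) :
  (forall i, tnth (ireq J) i = fset0) -> (forall i, tnth (isol J) i = false) ->
  BDIS_instance t J.
Proof.
move=> rE xE; split=> [i j|i|]; first by rewrite rE.
  by rewrite (_ : [set j | _] = set0) ?cards0 //; apply/setP => j;
    rewrite /edge !inE !rE.
have xT : accepted (isol J) = setT by apply/setP => i; rewrite !inE xE.
split; first exact: edgeless_independent.
apply/eqP; rewrite xT eqn_leq; apply/andP; split.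
  apply: (@leq_bigmax_cond _ (independent (ireq J)) (fun S => #|S|)).
  exact: edgeless_independent.
by apply/bigmax_leqP => S _; rewrite cardsT max_card.
Qed.

Lemma BDIS_attainable alpha beta gamma (A : online_algorithm {fset nat}) :
  (0 < t)%N ->
  competitive (P := BDIS R t) alpha beta gamma A ->
  attainable t alpha beta gamma.
Proof.
move=> t_gt0 [a0 b0 g0 [b H]]; rewrite /= in H.
have a1 : 1 <= alpha.
  rewrite -subr_le0; apply: (@linear_bounded_le0 _ _ b) => n.
  pose T := nseq n (fset0 : {fset nat}, false, false).
  have rE i : tnth (ireq (instance_of T)) i = fset0.
    by rewrite (tnth_ireq_instance_of (fset0, false, false)) nth_nseq if_same.
  have xE i : tnth (isol (instance_of T)) i = false.
    by rewrite (tnth_isol_instance_of (fset0, false, false)) nth_nseq if_same.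
  have JI := edgeless_BDIS_instance rE xE.
  have := H _ JI; rewrite /alg_value /= /BDIS_profit edgeless_independent //.
  rewrite (BDIS_opt_accepted JI) -EFinM -EFinD lee_fin.
  rewrite mu0_instance_of mu1_instance_of !big_nseq !iter_addr_0 /=.
  rewrite mul0r mulr0 !mul0rn !mulr0 !add0r.
  have -> : \sum_(i < size T) (1 - (tnth (isol (instance_of T)) i)%:R)
            = n%:R :> R.
    under eq_bigr => i _ do rewrite xE subr0.
    by rewrite sumr_const card_ord size_nseq.
  set S := \sum_(i < _) _; have : S <= n%:R.
    rewrite -[n in n%:R](size_nseq n (fset0 : {fset nat}, false, false)).
    rewrite -[size _]card_ord -sumr_const; apply: ler_sum => i _.
    by rewrite lerBlDr lerDl.
  by move=> Sn H1; have := ler_wpM2l a0 Sn; lra.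
split=> // q; apply: min_le0_or; set c := Num.min _ _.
apply: (@linear_bounded_le0 _ _ b) => n.
pose T := adversary t A q n.
have forest : star_forest t A T := star_forest_adversary A q n t_gt0.
have JI : BDIS_instance t (instance_of T).
  split; first exact: star_forest_arrival forest.
    exact: star_forest_degree forest t_gt0.
  exact: star_forest_maximum forest.
apply: le_trans (@adversary_potential R t A q c alpha beta gamma n _ _) _.
- by rewrite ge_min lexx.
- by rewrite ge_min lexx orbT.
have := H _ JI; rewrite /alg_value /= /BDIS_profit (BDIS_opt_accepted JI).
(* For an infeasible output, [alpha >= 1] makes the right-hand side [-oo], which contradicts the
   bound. *)
case: ifP => [ind|_]; last first.
  by rewrite gt0_muleNy ?lte_fin ?(lt_le_trans ltr01).
rewrite -EFinM -EFinD lee_fin mu0_instance_of mu1_instance_of -/T.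
set S := \sum_(i < _) _; set S' := \sum_(i < _) _ => H1.
have S'x : S' <= \sum_(z <- T) z.2%:R.
  rewrite big_tnth; apply: ler_sum => i _.
  have := star_forest_answer (i := i) forest ind.
  rewrite [tnth (isol _) i]tnth_map.
  case: (tnth (output _ _) i) => /= [_|->//]; last by rewrite subr0.
  by rewrite subrr.
have SE : S = \sum_(z <- T) (1 - z.2%:R).
  by rewrite big_tnth; apply: eq_bigr => i _; rewrite tnth_map.
have := ler_wpM2l a0 S'x; rewrite sumrB -SE !big_split /= -!mulr_sumr -/T.
lra.
Qed.

End BDIS.

Theorem theorem3p8 (R : realType) (t : nat) (t_gt0 : (0 < t)%N) :
  exactly_as_hard_as (BDIS R t) (ASG R t).
Proof.
split=> alpha beta gamma [A [compA _]]; have [_ b0 g0 _] := compA.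
  exact: ASG_competitive t_gt0 _ _ _ b0 g0 (BDIS_attainable t_gt0 compA).
exact: BDIS_competitive b0 g0 (ASG_attainable t_gt0 compA).
Qed.
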